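(* Let $\Theta\subseteq\mathbb R^d$ and let $\mathbf x=(\mathbf x_1,\dots,\mathbf x_n)\in\mathcal X^n$ be generated i.i.d. from the model $p(\cdot\mid\boldsymbol\theta)$ with true parameter $\boldsymbol\theta_0\in\operatorname{int}(\Theta)$. Let $\ell(\boldsymbol\theta)=\sum_{i=1}^n\log p(\mathbf x_i\mid\boldsymbol\theta)$ be the full-sample log-likelihood, $I(\boldsymbol\theta)$ the per-observation Fisher information matrix, $K(\boldsymbol\theta)=nI(\boldsymbol\theta)$, $\pi$ a prior density on $\Theta$, $\hat{\boldsymbol\theta}_{\rm MLE}$ the maximum likelihood estimator, and $\hat{\boldsymbol\theta}_{\rm WF}$ the Wallace--Freeman estimator $$\hat{\boldsymbol\theta}_{\rm WF}=\arg\min_{\boldsymbol\theta\in\Theta}\{-\ell(\boldsymbol\theta)+\operatorname{pen}(\boldsymbol\theta)\},\qquad \operatorname{pen}(\boldsymbol\theta)=-\log\pi(\boldsymbol\theta)+\tfrac12\log|I(\boldsymbol\theta)|.$$ Assume that: (C1) $\ell(\boldsymbol\theta)$ is twice continuously differentiable in a neighbourhood of $\boldsymbol\theta_0$, $\hat{\boldsymbol\theta}_{\rm MLE}$ is an interior root-$n$ consistent solution of $\nabla\ell(\boldsymbol\theta)=0$, and $\hat{\boldsymbol\theta}_{\rm MLE}$ satisfies the Cox--Snell expansion $$\operatorname{Bias}(\hat{\boldsymbol\theta}_{\rm MLE})=K(\boldsymbol\theta_0)^{-1}A(\boldsymbol\theta_0)\operatorname{vec}\bigl(K(\boldsymbol\theta_0)^{-1}\bigr)+O(n^{-2}),$$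 where $A(\boldsymbol\theta_0)$ is the Cox--Snell cumulant matrix; (C2) the observed information satisfies $-\nabla^2\ell(\hat{\boldsymbol\theta}_{\rm MLE})=K(\boldsymbol\theta_0)+O_p(n^{1/2})$, with $K(\boldsymbol\theta_0)$ nonsingular; (C3) $\hat{\boldsymbol\theta}_{\rm MLE}-\boldsymbol\theta_0=O_p(n^{-1/2})$; (C4) the vector $$\mathbf a(\boldsymbol\theta):=-\nabla_\theta\operatorname{pen}(\boldsymbol\theta)=\nabla_\theta\log\pi(\boldsymbol\theta)-\tfrac12\nabla_\theta\log|I(\boldsymbol\theta)|$$ is continuously differentiable in a neighbourhood of $\boldsymbol\theta_0$; (C5) the remainder $R_n=\nabla\ell(\hat{\boldsymbol\theta}_{\rm WF})-\nabla\ell(\hat{\boldsymbol\theta}_{\rm MLE})-\nabla^2\ell(\hat{\boldsymbol\theta}_{\rm MLE})(\hat{\boldsymbol\theta}_{\rm WF}-\hat{\boldsymbol\theta}_{\rm MLE})$ in the first-order Taylor expansion of $\nabla\ell(\hat{\boldsymbol\theta}_{\rm WF})$ about $\hat{\boldsymbol\theta}_{\rm MLE}$ is $o_p(n^{-1})$, and the corresponding error term $\hat{\boldsymbol\theta}_{\rm WF}-\hat{\boldsymbol\theta}_{\rm MLE}-K(\boldsymbol\theta_0)^{-1}\mathbf a(\boldsymbol\theta_0)$ is uniformly integrable after multiplication by $n$. Then $$\hat{\boldsymbol\theta}_{\rm WF}-\hat{\boldsymbol\theta}_{\rm MLE}=K(\boldsymbol\theta_0)^{-1}\mathbf a(\boldsymbol\theta_0)+o_p(n^{-1})=\frac1nI(\boldsymbol\theta_0)^{-1}\mathbf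 a(\boldsymbol\theta_0)+o_p(n^{-1}).$$ Moreover, $$\operatorname{Bias}(\hat{\boldsymbol\theta}_{\rm WF})=\operatorname{Bias}(\hat{\boldsymbol\theta}_{\rm MLE})+K(\boldsymbol\theta_0)^{-1}\mathbf a(\boldsymbol\theta_0)+o(n^{-1})=K(\boldsymbol\theta_0)^{-1}A(\boldsymbol\theta_0)\operatorname{vec}\bigl(K(\boldsymbol\theta_0)^{-1}\bigr)+K(\boldsymbol\theta_0)^{-1}\mathbf a(\boldsymbol\theta_0)+o(n^{-1}).$$
   Context: $|M|$ is the determinant of a matrix $M$, and $\operatorname{Bias}(\hat{\boldsymbol\theta})=\mathbb E_{\boldsymbol\theta_0}(\hat{\boldsymbol\theta}-\boldsymbol\theta_0)$. All stochastic orders are under $\boldsymbol\theta_0$ as $n\to\infty$. Cumulant matrix: write $\ell_{ij}=\partial^2\ell/\partial\theta_i\partial\theta_j$, $\ell_{ijk}=\partial^3\ell/\partial\theta_i\partial\theta_j\partial\theta_k$, $\kappa_{ij}(\boldsymbol\theta)=\mathbb E_{\boldsymbol\theta}\{\ell_{ij}(\boldsymbol\theta)\}$, $\kappa_{ijk}(\boldsymbol\theta)=\mathbb E_{\boldsymbol\theta}\{\ell_{ijk}(\boldsymbol\theta)\}$, $\kappa_{ij}^{(l)}=\partial\kappa_{ij}/\partial\theta_l$. Then $K(\boldsymbol\theta)=\{-\kappa_{ij}(\boldsymbol\theta)\}=nI(\boldsymbol\theta)$, and the $(d\times d^2)$ Cox--Snell cumulant matrix is $$A=\bigl[A^{(1)}\mid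 A^{(2)}\mid\cdots\mid A^{(d)}\bigr],\qquad A^{(l)}=\{a_{ij}^{\,l}\}_{i,j=1}^d,\qquad a_{ij}^{\,l}=\kappa_{ij}^{(l)}-\tfrac12\kappa_{ijl},\qquad i,j,l=1,\dots,d,$$ with $A(\boldsymbol\theta_0)$ its value at $\boldsymbol\theta_0$. $\operatorname{vec}$ stacks the columns of a matrix. *)

(* Defs.v *)
From HB Require Import structures.
From mathcomp Require Import all_boot all_order all_algebra finmap.
From mathcomp Require Import all_classical all_reals all_analysis.

Set Implicit Arguments.
Unset Strict Implicit.
Unset Printing Implicit Defensive.

Import Order.TTheory GRing.Theory Num.Theory.
Import numFieldNormedType.Exports.

Local Open Scope classical_set_scope.
Local Open Scope ring_scope.

(* Points of R^d are column vectors; the norm on matrices is the library's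
   entrywise maximum norm. *)

Section Calculus.
Context {R : realType} {d : nat}.
Implicit Types (f : 'cV[R]_d -> R) (theta : 'cV[R]_d) (U : set 'cV[R]_d).

Definition partial (i : 'I_d) f theta : R := 'D_(delta_mx i 0) f theta.

Definition grad f theta : 'cV[R]_d := \col_i partial i f theta.

Definition hessian f theta : 'M[R]_d :=
  \matrix_(i, j) partial j (partial i f) theta.

Definition has_partials U f : Prop :=
  forall i theta, U theta -> derivable f theta (delta_mx i 0).

(* All partial derivatives of [f] up to order [k] exist and are continuous at
   every point of [U]; used with [U] open. *)
Fixpoint C_on (k : nat) U f : Prop :=
  (forall theta, U theta -> {for theta, continuous f}) /\
  if k is k'.+1 then has_partials U f /\ forall i, C_on k' U (partial i f)
  else True.

(* [vec_cols M] stacks the columns of [M]. *)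
Definition vec_cols (M : 'M[R]_d) : 'cV[R]_(\sum_(l < d) d) :=
  \mxcol_(l < d) col l M.

End Calculus.

Section StochasticOrders.
Context {R : realType} {dO : measure_display} {Omega : measurableType dO}.
Variable P : probability Omega R.

(* The outer probability of [E] is at most [eps].  For measurable [E] this is
   [P E <= eps]; it is also meaningful for events involving derivatives of the
   log-likelihood at a random point, whose measurability is not assumed. *)
Definition outer_prob_le (E : set Omega) (eps : R) : Prop :=
  exists B, [/\ measurable B, E `<=` B & (P B <= eps%:E)%E].

Definition Op {V : normedModType R} (Y : nat -> Omega -> V) (r : nat -> R) :=
  forall eps : R, 0 < eps -> exists M : R, \forall n \near \oo,
    outer_prob_le [set w | M * r n < `|Y n w|] eps.

Definition op {V : normedModType R} (Y : nat -> Omega -> V) (r : nat -> R) :=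
  forall delta : R, 0 < delta -> forall eps : R, 0 < eps ->
    \forall n \near \oo, outer_prob_le [set w | delta * r n < `|Y n w|] eps.

Definition uniformly_integrable {V : normedModType R} (D : set nat)
    (Y : nat -> Omega -> V) : Prop :=
  forall eps : R, 0 < eps -> exists M : R, forall n, D n ->
    (\int[P]_(w in [set w | (M < `|Y n w|)%R]) `|Y n w|%:E <= eps%:E)%E.

Definition mutually_independent {dX : measure_display} {X : measurableType dX}
    (x : nat -> Omega -> X) : Prop :=
  forall (J : {fset nat}) (B : nat -> set X),
    (forall i, i \in J -> measurable (B i)) ->
    P (\bigcap_(i in [set` J]) (x i @^-1` B i)) =
    (\prod_(i <- J) P (x i @^-1` B i))%E.

Definition integrable_vector {d : nat} (T : Omega -> 'cV[R]_d) : Prop :=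
  forall i, P.-integrable setT (fun w => (T w i 0)%:E).

Definition bias {d : nat} (theta0 : 'cV[R]_d) (T : Omega -> 'cV[R]_d) :
  'cV[R]_d := \col_i fine ('E_P[fun w => (T w - theta0) i 0]).

End StochasticOrders.

Section Prior.
Context {R : realType}.

Fixpoint iterated_integral (d : nat) : (d.-tuple R -> \bar R) -> \bar R :=
  match d return (d.-tuple R -> \bar R) -> \bar R with
  | 0 => fun f => f [tuple]
  | d'.+1 => fun f => (\int[lebesgue_measure]_t
      iterated_integral (fun u : d'.-tuple R => f [tuple of t :: u]))%E
  end.

(* The iterated integral of a nonnegative Borel function on R^d is its
   Lebesgue integral, by Tonelli's theorem. *)
Definition is_prior_density {d : nat} (Theta : set 'cV[R]_d)
    (prior : 'cV[R]_d -> R) : Prop :=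
  let prior_on (u : d.-tuple R) : R :=
    (prior \_ Theta) (\col_i tnth u i) in
  [/\ forall theta, Theta theta -> 0 <= prior theta,
      measurable_fun setT prior_on &
      iterated_integral (fun u => (prior_on u)%:E) = 1%E].

End Prior.

Section Model.
Context {R : realType} {dX dO : measure_display}.
Context {X : measurableType dX} {Omega : measurableType dO} {d : nat}.
Variables (mu : {measure set X -> \bar R}) (p : X -> 'cV[R]_d -> R).
Variables (Theta : set 'cV[R]_d) (P : 'cV[R]_d -> probability Omega R).
Variables (x : nat -> Omega -> X) (prior : 'cV[R]_d -> R).
Implicit Types (theta : 'cV[R]_d) (n : nat).

Definition is_density_family : Prop :=
  forall theta, Theta theta ->
    [/\ measurable_fun setT (p^~ theta), forall z, 0 <= p z theta &
        (\int[mu]_z (p z theta)%:E = 1)%E].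

Definition iid_model : Prop :=
  (forall i, measurable_fun setT (x i)) /\
  forall theta, Theta theta ->
    mutually_independent (P theta) x /\
    forall i (B : set X), measurable B ->
      P theta (x i @^-1` B) = (\int[mu]_(z in B) (p z theta)%:E)%E.

Definition sample n (w : Omega) : n.-tuple X := [tuple x i w | i < n].

(* Extended-real valued: [-oo] where one of the densities vanishes. *)
Definition loglik n (s : n.-tuple X) theta : \bar R :=
  (\sum_(i < n) lne (p (tnth s i) theta)%:E)%E.

(* Differential calculus is done on the real-valued function [ell], which is
   the log-likelihood wherever the latter is finite. *)
Definition ell n (s : n.-tuple X) theta : R := fine (loglik s theta).

Definition kappa2 n (i j : 'I_d) theta : R :=
  fine ('E_(P theta)[fun w => partial j (partial i (ell (sample n w))) theta]).

Definition kappa3 n (i j k : 'I_d) theta : R :=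
  fine ('E_(P theta)[fun w =>
    partial k (partial j (partial i (ell (sample n w)))) theta]).

(* Per-observation information: minus the second-order cumulants of a sample
   of size one, so that [Kmat n] below is minus the matrix of second-order
   cumulants of a sample of size [n]. *)
Definition fisher theta : 'M[R]_d := \matrix_(i, j) - kappa2 1 i j theta.

Definition Kmat n theta : 'M[R]_d := n%:R *: fisher theta.

Definition cox_snell_block n (l : 'I_d) theta : 'M[R]_d :=
  \matrix_(i, j) (partial l (kappa2 n i j) theta - 2^-1 * kappa3 n i j l theta).

(* The d * d columns are indexed by the iterated sum, as in the library's block
   matrices; [vec_cols] uses the same indexing. *)
Definition cox_snell n theta : 'M[R]_(d, \sum_(l < d) d) :=
  \mxrow_(l < d) cox_snell_block n l theta.

Definition cox_snell_bias n theta : 'cV[R]_d :=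
  invmx (Kmat n theta) *m cox_snell n theta *m vec_cols (invmx (Kmat n theta)).

(* [lne r = -oo] for [r <= 0]. *)
Definition pen theta : \bar R :=
  (- lne (prior theta)%:E + (2^-1)%:E * lne (\det (fisher theta))%:E)%E.

Definition penR theta : R := fine (pen theta).

Definition avec theta : 'cV[R]_d := - grad penR theta.

Definition is_mle n (s : n.-tuple X) (that : 'cV[R]_d) : Prop :=
  Theta that /\
  forall theta, Theta theta -> (loglik s theta <= loglik s that)%E.

Definition is_wallace_freeman n (s : n.-tuple X) (that : 'cV[R]_d) : Prop :=
  Theta that /\
  forall theta, Theta theta ->
    (- loglik s that + pen that <= - loglik s theta + pen theta)%E.

(* An estimator is, for every sample size, a Borel function of the sample. *)
Definition is_estimator (T : forall n, n.-tuple X -> 'cV[R]_d) : Prop :=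
  forall n i, measurable_fun setT (fun s => T n s i 0).

Section Conditions.
Variables (theta0 : 'cV[R]_d) (mle wf : forall n, n.-tuple X -> 'cV[R]_d).

Let P0 := P theta0.
Let MLE n (w : Omega) := mle (sample n w).
Let WF n (w : Omega) := wf (sample n w).
Let ll n (w : Omega) := ell (sample n w).

(* One neighbourhood serves all sample sizes and almost all samples. *)
Definition loglik_C2 : Prop :=
  exists U, open_nbhs theta0 U /\ forall n, {ae P0, forall w,
    (forall theta, U theta -> loglik (sample n w) theta \is a fin_num) /\
    C_on 2 U (ll n w)}.

Definition mle_interior_root : Prop :=
  \forall n \near \oo, {ae P0, forall w,
    [/\ interior Theta (MLE n w), has_partials [set MLE n w] (ll n w) &
        grad (ll n w) (MLE n w) = 0]}.

Definition root_n_consistent : Prop :=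
  Op P0 (fun n w => MLE n w - theta0) (fun n => (Num.sqrt n%:R)^-1).

(* Integrability is what makes the bias meaningful: [fine] sends an infinite
   expectation to 0. *)
Definition cox_snell_expansion : Prop :=
  (\forall n \near \oo, integrable_vector P0 (MLE n)) /\
  (fun n => bias P0 theta0 (MLE n) - cox_snell_bias n theta0)
    =O_\oo (fun n => n%:R ^- 2 : R).

Definition condition_C1 : Prop :=
  [/\ loglik_C2, mle_interior_root, root_n_consistent & cox_snell_expansion].

Definition condition_C2 : Prop :=
  Op P0 (fun n w => - hessian (ll n w) (MLE n w) - Kmat n theta0)
    (fun n => Num.sqrt n%:R) /\
  forall n, (0 < n)%N -> Kmat n theta0 \in unitmx.

Definition condition_C3 : Prop := root_n_consistent.

Definition condition_C4 : Prop :=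
  exists V, [/\ open_nbhs theta0 V,
    forall theta, V theta -> 0 < prior theta /\ 0 < \det (fisher theta),
    has_partials V penR &
    forall i, C_on 1 V (fun theta => avec theta i 0)].

Definition remainder n (w : Omega) : 'cV[R]_d :=
  grad (ll n w) (WF n w) - grad (ll n w) (MLE n w)
  - hessian (ll n w) (MLE n w) *m (WF n w - MLE n w).

Definition error_term n (w : Omega) : 'cV[R]_d :=
  WF n w - MLE n w - invmx (Kmat n theta0) *m avec theta0.

Definition condition_C5 : Prop :=
  op P0 remainder (fun n => n%:R^-1) /\
  exists N, uniformly_integrable P0 [set n | (N <= n)%N]
    (fun n w => n%:R *: error_term n w).

End Conditions.
End Model.

(* Main.v *)
Require Import Defs.
From HB Require Import structures.
From mathcomp Require Import all_boot all_order all_algebra.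
From mathcomp Require Import all_classical all_reals all_analysis.
From mathcomp Require Import measurable_realfun ring.
Set Implicit Arguments.
Unset Strict Implicit.
Unset Printing Implicit Defensive.

Import Order.TTheory GRing.Theory Num.Theory.
Import numFieldNormedType.Exports.
Local Open Scope classical_set_scope.
Local Open Scope ring_scope.

(* Write D = WF - MLE, K = n I and e = D - K^-1 a(theta0).  Uniform
   integrability of n e already makes n e bounded in probability, so
   D = O_p(n^-1) and WF is consistent without any argmin argument.  With
   probability tending to one WF is then an interior local minimum of
   -ell + pen, whence grad ell (WF) = -a(WF); with E = -hess ell (MLE) - K the
   definition of the remainder R reads K D = a(WF) + R - E D, that is,
   e = n^-1 I^-1 (a(WF) - a(theta0) + R - E D).  Each of the three terms in the
   bracket is o_p(1).  The bias expansion follows since a uniformly integrable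
   sequence that is o_p(1) tends to 0 in L^1. *)

(** * Matrix norms and stochastic orders *)

Section MatrixNorm.
Context {R : realType}.

Lemma mx_norm_coord {m n} (A : 'M[R]_(m, n)) i j : `|A i j| <= `|A|.
Proof.
rewrite [leRHS]/Num.norm /= mx_normrE.
by apply/bigmax_geP; right => /=; exists (i, j).
Qed.

Lemma mx_norm_le {m n} (A : 'M[R]_(m, n)) c :
  0 <= c -> (forall i j, `|A i j| <= c) -> `|A| <= c.
Proof.
move=> c0 Ac; rewrite [leLHS]/Num.norm /= mx_normrE.
by apply/bigmax_leP; split=> // -[i j] _; exact: Ac.
Qed.

Lemma mulmx_norm_le {m n p} (A : 'M[R]_(m, n)) (B : 'M[R]_(n, p)) :
  `|A *m B| <= n%:R * (`|A| * `|B|).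
Proof.
apply: mx_norm_le => [|i j]; first by rewrite !mulr_ge0.
rewrite mxE (le_trans (ler_norm_sum _ _ _))//.
apply: (@le_trans _ _ (\sum_(k < n) `|A| * `|B|)).
  by apply: ler_sum => k _; rewrite normrM ler_pM ?mx_norm_coord.
by rewrite sumr_const card_ord mulr_natl.
Qed.

Lemma measurable_mx_norm {m n} {dO} {Omega : measurableType dO}
    (Y : Omega -> 'M[R]_(m, n)) :
  (forall i j, measurable_fun setT (fun w => Y w i j)) ->
  measurable_fun setT (fun w => `|Y w|).
Proof.
move=> mY; under eq_fun do rewrite [Num.norm (Y _)]/Num.norm /= mx_normrE.
elim: (index_enum _) => [|[i j] s ih].
  by under eq_fun do rewrite big_nil; exact: measurable_cst.
under eq_fun do rewrite big_cons.
by apply: measurable_maxr => //; apply: measurableT_comp => //; exact: mY.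
Qed.

End MatrixNorm.

Section StochasticOrderCalculus.
Context {R : realType} {dO : measure_display} {Omega : measurableType dO}.
Variable P : probability Omega R.
Implicit Types (r s : nat -> R) (E F : set Omega).

(** An event holds with probability tending to one when its complement is [vanishing]. Outer
    probability lets this apply to events about derivatives at random points, which need not be
    measurable. *)
Definition vanishing (E : nat -> set Omega) : Prop :=
  forall eps : R, 0 < eps -> \forall n \near \oo, outer_prob_le P (E n) eps.

Lemma outer_prob_le_sub E F eps :
  E `<=` F -> outer_prob_le P F eps -> outer_prob_le P E eps.
Proof. by move=> EF [B [mB FB PB]]; exists B; split=> // w /EF /FB. Qed.

Lemma outer_prob_leU E F e1 e2 : outer_prob_le P E e1 ->
  outer_prob_le P F e2 -> outer_prob_le P (E `|` F) (e1 + e2).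
Proof.
move=> [A [mA EA PA]] [B [mB FB PB]]; exists (A `|` B); split.
- exact: measurableU.
- exact: setUSS.
- by rewrite EFinD (le_trans (measureU2 _ mA mB))// leeD.
Qed.

Lemma outer_prob_le_ae (Q : set Omega) eps :
  0 <= eps -> {ae P, forall w, Q w} -> outer_prob_le P (~` Q) eps.
Proof.
by move=> e0 [B [mB PB QB]]; exists B; split=> //; rewrite PB lee_fin.
Qed.

Lemma vanishing_sub (E F : nat -> set Omega) :
  (\forall n \near \oo, E n `<=` F n) -> vanishing F -> vanishing E.
Proof.
move=> EF vF eps e0; near=> n; apply: (@outer_prob_le_sub _ (F n)).
- by near: n; exact: EF.
- by near: n; exact: vF.
Unshelve. all: by end_near. Qed.

Lemma vanishingU (E F : nat -> set Omega) :
  vanishing E -> vanishing F -> vanishing (fun n => E n `|` F n).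
Proof.
move=> vE vF eps e0; rewrite (splitr eps); near=> n; apply: outer_prob_leU.
- by near: n; apply: vE; rewrite divr_gt0.
- by near: n; apply: vF; rewrite divr_gt0.
Unshelve. all: by end_near. Qed.

Lemma vanishing_ae (Q : nat -> set Omega) :
  (\forall n \near \oo, {ae P, forall w, Q n w}) ->
  vanishing (fun n => ~` Q n).
Proof.
move=> aeQ eps e0; near=> n; apply: outer_prob_le_ae; first exact: ltW.
by near: n.
Unshelve. all: by end_near. Qed.

Lemma opP {V : normedModType R} (Y : nat -> Omega -> V) r :
  op P Y r <-> forall delta, 0 < delta ->
    vanishing (fun n => [set w | delta * r n < `|Y n w|]).
Proof. by []. Qed.

Lemma opD {V : normedModType R} (Y Z : nat -> Omega -> V) r :
  op P Y r -> op P Z r -> op P (fun n w => Y n w + Z n w) r.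
Proof.
move=> /opP hY /opP hZ; apply/opP => delta d0.
have d2 : 0 < delta / 2 by rewrite divr_gt0.
apply: (vanishing_sub _ (vanishingU (hY _ d2) (hZ _ d2))).
apply: nearW => n w /=; apply: contraPP => /not_orP[/negP + /negP].
rewrite -!leNgt => Yd Zd; apply/negP.
by rewrite -leNgt (le_trans (ler_normD _ _))// (splitr delta) mulrDl lerD.
Qed.

Lemma op_le {V : normedModType R} (Y : nat -> Omega -> V) r s :
  (\forall n \near \oo, r n <= s n) -> op P Y r -> op P Y s.
Proof.
move=> rs /opP hY; apply/opP => delta d0; apply: (vanishing_sub _ (hY _ d0)).
near=> n => w /=; apply: le_lt_trans; rewrite ler_pM2l//.
by near: n.
Unshelve. all: by end_near. Qed.

(** Lets an algebraic identity that holds only with probability tending to one be used as if it held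
    everywhere. *)
Lemma op_eq {V : normedModType R} (Y Z : nat -> Omega -> V) r :
  vanishing (fun n => [set w | Y n w <> Z n w]) -> op P Z r -> op P Y r.
Proof.
move=> YZ /opP hZ; apply/opP => delta d0.
apply: (vanishing_sub _ (vanishingU YZ (hZ _ d0))); apply: nearW => n w /=.
by have [-> |] := pselect (Y n w = Z n w); [right|left].
Qed.

Lemma OpD {V : normedModType R} (Y Z : nat -> Omega -> V) r :
  Op P Y r -> Op P Z r -> Op P (fun n w => Y n w + Z n w) r.
Proof.
move=> hY hZ eps e0; have e2 : 0 < eps / 2 by rewrite divr_gt0.
have [M hM] := hY _ e2; have [N hN] := hZ _ e2.
exists (M + N); rewrite (splitr eps); near=> n.
apply: (@outer_prob_le_sub _
  ([set w | M * r n < `|Y n w|] `|` [set w | N * r n < `|Z n w|])).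
  move=> w /=; apply: contraPP => /not_orP[/negP + /negP].
  rewrite -!leNgt => Yd Zd; apply/negP.
  by rewrite -leNgt (le_trans (ler_normD _ _))// mulrDl lerD.
by apply: outer_prob_leU; near: n.
Unshelve. all: by end_near. Qed.

Lemma Op_mulmx {m n p} (A : nat -> Omega -> 'M[R]_(m, n))
    (B : nat -> Omega -> 'M[R]_(n, p)) r s : Op P A r -> Op P B s ->
  Op P (fun k w => A k w *m B k w) (fun k => r k * s k).
Proof.
move=> hA hB eps e0; have e2 : 0 < eps / 2 by rewrite divr_gt0.
have [M hM] := hA _ e2; have [N hN] := hB _ e2.
(* The factor [n%:R] is the inner dimension, which the entrywise maximum norm loses in
   [mulmx_norm_le]. *)
exists (n%:R * (M * N)); rewrite (splitr eps); near=> k.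
apply: (@outer_prob_le_sub _
  ([set w | M * r k < `|A k w|] `|` [set w | N * s k < `|B k w|])).
  move=> w /=; apply: contraPP => /not_orP[/negP + /negP].
  rewrite -!leNgt => Ad Bd; apply/negP.
  rewrite -leNgt (le_trans (mulmx_norm_le _ _))// -mulrA ler_wpM2l//.
  by rewrite mulrACA ler_pM.
by apply: outer_prob_leU; near: k.
Unshelve. all: by end_near. Qed.

Lemma Op_op1 {V : normedModType R} (Y : nat -> Omega -> V) r :
  r @ \oo --> (0 : R) -> Op P Y r -> op P Y (fun=> 1).
Proof.
move=> r0 hY delta d0 eps e0; have [M hM] := hY _ e0.
have Mr0 : M * r n @[n --> \oo] --> (0 : R).
  by rewrite -(mulr0 M); apply: cvgMr.
near=> n; apply: (@outer_prob_le_sub _ [set w | M * r n < `|Y n w|]).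
  move=> w /=; apply: le_lt_trans; rewrite mulr1 ltW//.
  by near: n; apply: cvgr_lt Mr0 _ _.
by near: n.
Unshelve. all: by end_near. Qed.

Lemma op1_nbhs {V : normedModType R} (T : nat -> Omega -> V) a (U : set V) :
  op P (fun n w => T n w - a) (fun=> 1) -> nbhs a U ->
  vanishing (fun n => ~` (T n @^-1` U)).
Proof.
move=> /opP hT /nbhs_ballP[delta /= d0 aU].
(* Off the exceptional event the bound is non-strict; halving [delta] recovers the strict inequality
   of the open ball. *)
have d2 : 0 < delta / 2 by rewrite divr_gt0.
apply: (vanishing_sub _ (hT _ d2)); apply: nearW => n w /=.
apply: contra_notP => /negP; rewrite -leNgt mulr1 => Td; apply: aU.
rewrite -ball_normE /= distrC (le_lt_trans Td)//.
by rewrite ltr_pdivrMr// ltr_pMr// ltr1n.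
Qed.

Lemma op1_continuous {V W : normedModType R} (T : nat -> Omega -> V) a
    (g : V -> W) : op P (fun n w => T n w - a) (fun=> 1) ->
  {for a, continuous g} -> op P (fun n w => g (T n w) - g a) (fun=> 1).
Proof.
move=> hT cg; apply/opP => delta d0.
have /(op1_nbhs hT) : nbhs a (g @^-1` ball (g a) delta).
  by apply: cg; exact: nbhsx_ballx.
apply: vanishing_sub; apply: nearW => n w /=; rewrite mulr1.
by rewrite -ball_normE /= distrC => /lt_gtF ->.
Qed.

Lemma op_scale_mulmx {m n p} (A : 'M[R]_(m, n))
    (Y : nat -> Omega -> 'M[R]_(n, p)) : op P Y (fun=> 1) ->
  op P (fun k w => k%:R^-1 *: (A *m Y k w)) (fun k => k%:R^-1).
Proof.
(* Adding 1 keeps [c] positive even when [n%:R * |A|] is zero, so that [delta / c] is an admissible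
   threshold. *)
move=> /opP hY; apply/opP => delta d0; pose c := n%:R * `|A| + 1.
have c0 : 0 < c by rewrite ltr_wpDl// mulr_ge0.
apply: (vanishing_sub _ (hY _ (divr_gt0 d0 c0))); apply: nearW => k w /=.
rewrite mulr1 normrZ ger0_norm ?invr_ge0// mulrC => dY.
rewrite ltr_pdivrMr// mulrC.
(* At [k = 0] the inverse is 0 by convention, and [dY] would read [0 < 0]. *)
have k0 : 0 < (k%:R^-1 : R).
  rewrite lt_def invr_ge0 ler0n andbT; apply: contraPneq dY => ->.
  by rewrite !mul0r ltxx.
rewrite ltr_pM2l// in dY; rewrite (lt_le_trans dY)//.
rewrite (le_trans (mulmx_norm_le _ _))// mulrA ler_wpM2r//.
by rewrite /c lerDl.
Qed.

End StochasticOrderCalculus.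

(** * Uniform integrability *)

Section UniformIntegrability.
Context {R : realType} {dO : measure_display} {Omega : measurableType dO}.
Variable P : probability Omega R.

Lemma measurable_gt_level (f : Omega -> R) a :
  measurable_fun setT f -> measurable [set w | a < f w].
Proof.
move=> mf; rewrite [X in measurable X](_ : _ = setT `&` f @^-1` `]a, +oo[).
  exact: mf.
by rewrite setTI; apply/seteqP; split=> w /=; rewrite in_itv /= andbT.
Qed.

(** Integrates the pointwise bound of [f] by [f 1_{f > M} + M 1_{f > delta} + delta]: large values
    are left to uniform integrability, intermediate ones to convergence in probability, small ones
    to [delta]. *)
Lemma le_integral_truncation (f : Omega -> R) M delta :
  measurable_fun setT f -> (forall w, 0 <= f w) -> 0 <= M -> 0 <= delta ->
  (\int[P]_w (f w)%:E <= \int[P]_(w in [set w | (M < f w)%R]) (f w)%:E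
     + M%:E * P [set w | (delta < f w)%R] + delta%:E)%E.
Proof.
move=> mf f0 M0 d0.
set A := [set w | M < f w]; set B := [set w | delta < f w].
have mA : measurable A by exact: measurable_gt_level.
have mB : measurable B by exact: measurable_gt_level.
pose g w : \bar R := ((fun w => (f w)%:E) \_ A) w.
have g0 w : (0 <= g w)%E by rewrite /g patchE; case: ifP; rewrite ?lee_fin.
have mg : measurable_fun setT g.
  apply/(measurable_restrictT _ mA); apply: measurable_funTS.
  exact/measurable_EFinP.
have mi : measurable_fun setT (fun w => (\1_B w)%:E : \bar R).
  by apply/measurable_EFinP.
have mMi : measurable_fun setT (fun w => (M%:E * (\1_B w)%:E)%E).
  exact: measurable_funeM.
have Mi0 w : (0 <= M%:E * (\1_B w)%:E)%E by rewrite -EFinM lee_fin mulr_ge0.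
have -> : (\int[P]_(w in A) (f w)%:E + M%:E * P B + delta%:E =
    \int[P]_w (g w + M%:E * (\1_B w)%:E + delta%:E))%E.
  rewrite ge0_integralD//=; first last.
  - exact: emeasurable_funD.
  - by move=> w _; rewrite adde_ge0.
  rewrite ge0_integralD// ge0_integralZl_EFin//.
  rewrite integral_indic// setIT integral_cst//=.
  rewrite [in LHS]integral_mkcond; congr (_ + _)%E.
  by rewrite -[LHS]mule1 -(probability_setT P).
apply: ge0_le_integral => //=.
- by move=> w _; rewrite lee_fin.
- exact/measurable_EFinP.
- by apply: emeasurable_funD => //; exact: emeasurable_funD.
(* The pointwise bound, by cases: [f w] above [M], then between [delta] and [M], then at most
   [delta]. *)
- move=> w _; rewrite /g patchE indicE -EFinM.
  case: ifPn => [_|].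
    by rewrite -!EFinD lee_fin -addrA lerDl addr_ge0// mulr_ge0.
  rewrite add0e -EFinD lee_fin notin_setE /= => /negP; rewrite -leNgt => fM.
  have [|] := boolP (w \in B); first by rewrite mulr1 (le_trans fM)// lerDl.
  by rewrite notin_setE /= mulr0 add0r => /negP; rewrite -leNgt.
Qed.

Context {V : normedModType R} (N : nat) (Y : nat -> Omega -> V).
Hypothesis mY : forall n, measurable_fun setT (fun w => `|Y n w|).
Hypothesis uiY : uniformly_integrable P [set n | (N <= n)%N] Y.

(** Markov's inequality on the tail: above the level [max M 1] the norm is at least 1, so the
    probability of the tail is at most the tail integral, itself at most [eps]. *)
Lemma uniformly_integrable_Op : Op P Y (fun=> 1).
Proof.
move=> eps e0; have [M hM] := uiY e0; exists (Num.max M 1).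
exists N => // n /= Nn.
have mS a := measurable_gt_level a (mY n).
exists [set w | Num.max M 1 < `|Y n w|]; split=> //.
  by move=> w /=; rewrite mulr1.
apply: le_trans (hM n Nn).
rewrite -[leLHS]mul1e -integral_cst//.
apply: (@le_trans _ _
  (\int[P]_(w in [set w | (Num.max M 1 < `|Y n w|)%R]) `|Y n w|%:E)%E).
  apply: ge0_le_integral => //=.
  - by apply/measurable_EFinP; apply: measurable_funTS.
  - by move=> w; rewrite gt_max lee_fin => /andP[_ /ltW].
apply: ge0_subset_integral => //=.
- by apply/measurable_EFinP; apply: measurable_funTS.
- by move=> w /=; rewrite gt_max => /andP[].
Qed.

Lemma uniformly_integrable_lty n : (N <= n)%N ->
  (\int[P]_w `|Y n w|%:E < +oo)%E.
Proof.
move=> Nn; have [M hM] := uiY ltr01.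
have mS a := measurable_gt_level a (mY n).
(* Truncation with [delta = 0]. The level [M] may be negative, so [|M|] replaces it; this only
   shrinks the tail. *)
apply: le_lt_trans (le_integral_truncation (mY n) _ (normr_ge0 M)
  (lexx 0)) _ => //.
apply: (@le_lt_trans _ _ (1%:E + `|M|%:E * 1%:E + 0%:E)%E); last first.
  by rewrite -EFinM -!EFinD ltry.
apply: leeD => //; apply: leeD.
  apply: le_trans (hM n Nn); apply: ge0_subset_integral => //=.
  - by apply/measurable_EFinP; apply: measurable_funTS.
  - by move=> w /=; apply: le_lt_trans; exact: ler_norm.
by rewrite lee_wpmul2l ?lee_fin// probability_le1.
Qed.

(** The Vitali argument: each of the three terms of the truncation bound receives [eps / 3]. *)
Lemma uniformly_integrable_op_integral (eps : R) : op P Y (fun=> 1) ->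
  0 < eps -> \forall n \near \oo, (\int[P]_w `|Y n w|%:E <= eps%:E)%E.
Proof.
move=> opY e0; have e3 : 0 < eps / 3 by rewrite divr_gt0.
have [M hM] := uiY e3.
(* [K] exceeds [M] and is positive, so the intermediate values may be given probability
   [eps / 3 / K]. *)
pose K := `|M| + 1; have K0 : 0 < K by rewrite ltr_wpDl.
near=> n.
have Nn : (N <= n)%N by near: n; exact: nbhs_infty_ge.
have mS a := measurable_gt_level a (mY n).
apply: le_trans (le_integral_truncation (mY n) _ (ltW K0) (ltW e3)) _ => //.
have -> : (eps%:E = (eps / 3)%:E + K%:E * (eps / 3 / K)%:E + (eps / 3)%:E)%E.
  by rewrite -EFinM [K * _]mulrC divfK ?gt_eqF// -!EFinD; congr EFin; field.
apply: leeD => //; apply: leeD.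
  apply: le_trans (hM n Nn); apply: ge0_subset_integral => //=.
  - by apply/measurable_EFinP; apply: measurable_funTS.
  - move=> w /=; apply: le_lt_trans.
    by rewrite (le_trans (ler_norm _))// lerDl.
rewrite lee_wpmul2l ?lee_fin ?(ltW K0)//.
have [B [mB SB PB]] : outer_prob_le P
    [set w | eps / 3 * 1 < `|Y n w|] (eps / 3 / K).
  by near: n; apply: opY => //; rewrite divr_gt0.
apply: le_trans PB; apply: le_measure; rewrite ?inE//.
by move=> w /= hw; apply: SB => /=; rewrite mulr1.
Unshelve. all: by end_near. Qed.

End UniformIntegrability.

(** Restricting [f] to the line through [a] with direction [v] reduces the claim to the one-variable
    Fermat rule. That rule asks for derivability on an open interval, hence the requirement at all
    [b] near [a]. *)
Lemma derive_local_min (R : realType) (V : normedModType R) (f : V -> R)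
    (a v : V) :
  (\forall b \near a, derivable f b v /\ f a <= f b) -> 'D_v f a = 0.
Proof.
move=> fa; pose g (t : R) := f (a + t *: v).
(* [g] at [t] and [f] at [a + t *: v] along [v] have the same difference quotients, so derivability
   and derivatives transfer without a chain rule. *)
have quot t : (fun h => h^-1 *: ((g \o shift t) (h *: 1) - g t)) =
    (fun h => h^-1 *: ((f \o shift (a + t *: v)) (h *: v) - f (a + t *: v))).
  apply/funext => h; rewrite /g /= scalerDl addrCA [h *: 1]mulr1.
  by congr (_ *: (f _ - _)); rewrite addrCA.
have cg : a + t *: v @[t --> (0 : R)] --> a.
  rewrite -[X in _ --> X]addr0 -(scale0r v).
  by apply: cvgD; [exact: cvg_cst|apply: cvgZr_tmp; exact: cvg_id].
have /nbhs_ballP[e /= e0 he] := cg _ fa.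
have {}he t : t \in `]- e, e[%R ->
    derivable f (a + t *: v) v /\ f a <= f (a + t *: v).
  move=> te; apply: he; rewrite -ball_normE /= sub0r normrN ltr_norml.
  by move: te; rewrite in_itv.
have g0 : g 0 = f a by rewrite /g scale0r addr0.
have /(@derive_val _ _ _ _ _ _ _) : is_derive (0 : R) 1 g 0.
  apply: (@derive1_at_min _ _ (- e) e).
  - by rewrite ge0_cp// ltW.
  - by move=> t /he[df _]; rewrite /derivable quot.
  - by rewrite in_itv /= oppr_lt0 e0.
  - by move=> t /he[_]; rewrite g0.
by rewrite /derive quot scale0r addr0.
Qed.

(** * Rescaling stochastic orders by the sample size *)

Section Scaling.
Context {R : realType} {dO : measure_display} {Omega : measurableType dO}.
Variable P : probability Omega R.
Context {V : normedModType R}.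
Implicit Types (Y Z : nat -> Omega -> V) (r : nat -> R).

Lemma opN Y r : op P Y r -> op P (fun n w => - Y n w) r.
Proof.
move=> hY delta d0 eps e0; apply: filterS (hY _ d0 _ e0) => n.
by apply: outer_prob_le_sub => w /=; rewrite normrN.
Qed.

Lemma Op_near_eq Y Z r :
  (\forall n \near \oo, Y n = Z n) -> Op P Z r -> Op P Y r.
Proof.
move=> YZ hZ eps e0; have [M hM] := hZ _ e0; exists M.
by apply: filterS2 YZ hM => n ->.
Qed.

Lemma Op_cst (v : V) : Op P (fun _ _ => v) (fun=> 1).
Proof.
move=> eps e0; exists `|v|; apply: nearW => n; exists set0; split=> //.
  by move=> w /=; rewrite mulr1 ltxx.
by rewrite measure0 lee_fin ltW.
Qed.

Lemma Op_scale Y : Op P Y (fun=> 1) ->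
  Op P (fun n w => n%:R^-1 *: Y n w) (fun n => n%:R^-1).
Proof.
move=> hY eps e0; have [M hM] := hY _ e0; exists M.
near=> n; apply: (@outer_prob_le_sub _ _ _ _ _ [set w | M * 1 < `|Y n w|]).
  move=> w /=; rewrite normrZ ger0_norm ?invr_ge0// [M * _]mulrC mulr1.
  by rewrite ltr_pM2l// invr_gt0 ltr0n; near: n; exact: nbhs_infty_gt.
by near: n.
Unshelve. all: by end_near. Qed.

Lemma op_unscale Y : op P Y (fun n => n%:R^-1) ->
  op P (fun n w => n%:R *: Y n w) (fun=> 1).
Proof.
move=> hY delta d0 eps e0; near=> n.
apply: (@outer_prob_le_sub _ _ _ _ _ [set w | delta * n%:R^-1 < `|Y n w|]).
  move=> w /=; rewrite normrZ ger0_norm// mulr1.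
  rewrite ltr_pdivrMr 1?mulrC// ltr0n; near: n; exact: nbhs_infty_gt.
by near: n; exact: hY.
Unshelve. all: by end_near. Qed.

End Scaling.

Lemma cvg_inv_nat (R : realType) : (n%:R^-1 : R) @[n --> \oo] --> (0 : R).
Proof.
apply/(@gtr0_cvgV0 R nat \oo _ (fun n => n%:R)); last exact: cvgr_idn.
by near=> n; rewrite ltr0n; near: n; exact: nbhs_infty_gt.
Unshelve. all: by end_near. Qed.

Lemma cvg_inv_sqrt_nat (R : realType) :
  ((Num.sqrt n%:R)^-1 : R) @[n --> \oo] --> (0 : R).
Proof.
rewrite -[X in _ --> X](sqrtr0 R).
under eq_fun do rewrite -sqrtrV//.
exact: continuous_cvg (@sqrt_continuous R 0) (@cvg_inv_nat R).
Qed.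

(** With [Y = n (T - S - c)], the identity [T = S + c + n^-1 Y] makes the bias difference equal to
    [n^-1] times the mean of [Y]. This mean tends to 0, since [Y] is uniformly integrable and
    o_p(1). The same identity makes [T] integrable, so its bias is a genuine expectation. *)
Lemma bias_littleo {R : realType} {dO : measure_display}
    {Omega : measurableType dO} (P : probability Omega R) {d : nat}
    (theta0 : 'cV[R]_d) (T S : nat -> Omega -> 'cV[R]_d)
    (c : nat -> 'cV[R]_d) N :
  (forall n i, measurable_fun setT (fun w => T n w i 0)) ->
  (forall n i, measurable_fun setT (fun w => S n w i 0)) ->
  (\forall n \near \oo, integrable_vector P (S n)) ->
  uniformly_integrable P [set n | (N <= n)%N]
    (fun n w => n%:R *: (T n w - S n w - c n)) ->
  op P (fun n w => T n w - S n w - c n) (fun n => n%:R^-1) ->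
  (\forall n \near \oo, integrable_vector P (T n)) /\
  (fun n => bias P theta0 (T n) - (bias P theta0 (S n) + c n))
    =o_\oo (fun n => n%:R^-1 : R).
Proof.
move=> mT mS iS; set Y := fun n w => n%:R *: (T n w - S n w - c n).
move=> uiY /op_unscale opY.
have mYi n i : measurable_fun setT (fun w => Y n w i 0).
  under eq_fun do rewrite !mxE.
  by apply: measurable_funM => //; apply: measurable_funB => //;
    apply: measurable_funB.
have mY n : measurable_fun setT (fun w => `|Y n w|).
  by apply: measurable_mx_norm => i j; rewrite ord1; exact: mYi.
have leYi n i : (\int[P]_w `|(Y n w i 0)%:E| <= \int[P]_w `|Y n w|%:E)%E.
  apply: ge0_le_integral => //=.
  - by apply/measurable_EFinP; apply: measurableT_comp.
  - exact/measurable_EFinP.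
  - by move=> w _; rewrite lee_fin mx_norm_coord.
have iYi n i : (N <= n)%N -> P.-integrable setT (fun w => (Y n w i 0)%:E).
  move=> Nn; apply/integrableP; split; first exact/measurable_EFinP.
  exact: le_lt_trans (leYi n i) (uniformly_integrable_lty mY uiY Nn).
have TE n i w : (0 < n)%N ->
    T n w i 0 = S n w i 0 + (c n i 0 + n%:R^-1 * Y n w i 0).
  move=> n0; rewrite !mxE mulKf ?pnatr_eq0 -?lt0n//.
  by ring.
have icst (k : R) : P.-integrable setT (fun=> k%:E).
  exact: (finite_measure_integrable_cst P k measurableT).
have iT : \forall n \near \oo, integrable_vector P (T n).
  near=> n => i.
  have n0 : (0 < n)%N by near: n; exact: nbhs_infty_gt.
  have Nn : (N <= n)%N by near: n; exact: nbhs_infty_ge.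
  have iSi : P.-integrable setT (fun w => (S n w i 0)%:E) by move: i; near: n.
  under eq_fun do rewrite TE// !EFinD EFinM.
  apply: integrableD => //; apply: integrableD => //.
  exact: integrableZl (iYi _ _ _).
split=> //; apply/eqoP => eps e0; near=> n.
have n0 : (0 < n)%N by near: n; exact: nbhs_infty_gt.
have Nn : (N <= n)%N by near: n; exact: nbhs_infty_ge.
apply: mx_norm_le => [|i j]; first by rewrite mulr_ge0// ltW.
rewrite ord1 !mxE.
have iSi : P.-integrable setT (fun w => (S n w i 0)%:E) by move: i; near: n.
have iSc : P.-integrable setT (fun w => ((S n w - theta0) i 0)%:E).
  under eq_fun do rewrite !mxE EFinD.
  exact: integrableD.
have -> : ('E_P[fun w => (T n w - theta0)%R i 0%R] =
    'E_P[fun w => (S n w - theta0)%R i 0%R] + ((c n i 0)%:E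
      + n%:R^-1%:E * \int[P]_w (Y n w i 0)%:E))%E.
  rewrite unlock -integralZl//; last exact: iYi.
  have iZ : P.-integrable setT (fun w => n%:R^-1%:E * (Y n w i 0)%:E)%E.
    exact: integrableZl (iYi _ _ _).
  transitivity (\int[P]_w (((S n w - theta0) i 0)%:E +
      ((c n i 0)%:E + n%:R^-1%:E * (Y n w i 0)%:E)))%E.
    apply: eq_integral => w _; rewrite -EFinM -!EFinD; congr EFin.
    have subE (v : 'cV[R]_d) : (v - theta0) i 0 = v i 0 - theta0 i 0.
      by rewrite !mxE.
    by rewrite !subE TE//; ring.
  rewrite integralD//=; last exact: integrableD.
  rewrite integralD//= integral_cst//=; congr (_ + (_ + _))%E.
  by rewrite -[RHS]mule1 -(probability_setT P).
(* Finiteness is what allows [fine] to be distributed over the sum and the product. *)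
have fY : (\int[P]_w (Y n w i 0)%:E)%E \is a fin_num.
  by apply: integrable_fin_num => //; exact: iYi.
have fS : ('E_P[fun w => (S n w - theta0)%R i 0%R])%E \is a fin_num.
  by rewrite unlock; exact: integrable_fin_num.
rewrite fineD//; last by rewrite fin_numD fin_numM.
rewrite fineD ?fin_numM// fineM//= addrA addrC addKr.
rewrite normrM mulrC ler_wpM2r//.
rewrite -lee_fin -fine_abse// fineK ?abse_fin_num//.
apply: le_trans (le_abse_integral P measurableT _) _.
  exact/measurable_EFinP.
apply: le_trans (leYi n i) _; near: n.
exact: (uniformly_integrable_op_integral mY uiY opY e0).
Unshelve. all: by end_near. Qed.

(** * Stationarity of the Wallace--Freeman estimator *)

Section Stationarity.
Context {R : realType} {dX dO : measure_display}.
Context {X : measurableType dX} {Omega : measurableType dO} {d : nat}.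
Variables (p : X -> 'cV[R]_d -> R).
Variables (Theta : set 'cV[R]_d) (P : 'cV[R]_d -> probability Omega R).
Variables (x : nat -> Omega -> X) (prior : 'cV[R]_d -> R).

(** Fermat's rule for [penR - ell]. The neighbourhood lies in [Theta], so the global minimiser is a
    local one there, and finiteness of [loglik] and [pen] turns the extended-real inequality into
    one between real functions. *)
Lemma wallace_freeman_stationary n (s : n.-tuple X) that :
  is_wallace_freeman p Theta P x prior s that ->
  (\forall theta \near that, Theta theta /\
    [/\ loglik p s theta \is a fin_num, pen p P x prior theta \is a fin_num,
        forall i, derivable (ell p s) theta (delta_mx i 0) &
        forall i, derivable (penR p P x prior) theta (delta_mx i 0)]) ->
  grad (ell p s) that = - avec p P x prior that.
Proof.
move=> [_ wf_min] near_that.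
apply/colP => i; rewrite !mxE opprK /partial.
have [_ [l0 q0 dl dq]] := nbhs_singleton near_that.
apply/esym/eqP; rewrite -subr_eq0 -deriveB//; apply/eqP.
apply: derive_local_min; apply: filterS near_that => b [Tb [lb qb dlb dqb]].
split; first exact: derivableB.
have := wf_min b Tb; rewrite /penR /ell.
rewrite -(fineK l0) -(fineK q0) -(fineK lb) -(fineK qb) -!EFinN -!EFinD lee_fin.
by rewrite /= [- _ + _]addrC [leRHS]addrC.
Qed.

Lemma pen_fin_num theta : 0 < prior theta -> 0 < \det (fisher p P x theta) ->
  pen p P x prior theta \is a fin_num.
Proof. by move=> q0 D0; rewrite /pen !lne_EFin. Qed.

End Stationarity.

Lemma continuous_col {R : realType} {V : topologicalType} {d : nat}
    (f : V -> 'cV[R]_d) a :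
  (forall i, {for a, continuous (fun t => f t i 0)}) -> {for a, continuous f}.
Proof.
move=> fi; apply/cvgrPdist_le => e e0.
have : \forall t \near a, forall i, `|f a i 0 - f t i 0| <= e.
  by apply: filter_forall => i; have /cvgrPdist_le := fi i; apply.
apply: filterS => t ft; apply: mx_norm_le; first exact: ltW.
by move=> i j; rewrite ord1 !mxE.
Qed.

(** * The Wallace--Freeman expansion and its bias *)

Theorem theorem5p1 (R : realType) (dX dO : measure_display)
    (X : measurableType dX) (Omega : measurableType dO) (d : nat)
    (mu : {measure set X -> \bar R}) (p : X -> 'cV[R]_d -> R)
    (Theta : set 'cV[R]_d) (P : 'cV[R]_d -> probability Omega R)
    (x : nat -> Omega -> X) (prior : 'cV[R]_d -> R)
    (theta0 : 'cV[R]_d) (mle wf : forall n : nat, n.-tuple X -> 'cV[R]_d)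
    (hd : (0 < d)%N)
    (hp : is_density_family mu p Theta)
    (hx : iid_model mu p Theta P x)
    (htheta0 : interior Theta theta0)
    (hprior : is_prior_density Theta prior)
    (hmle : is_estimator mle)
    (hwf : is_estimator wf)
    (hMLE : \forall n \near \oo, {ae P theta0, forall w,
       is_mle p Theta (sample x n w) (mle n (sample x n w))})
    (hWF : \forall n \near \oo, {ae P theta0, forall w,
       is_wallace_freeman p Theta P x prior (sample x n w)
         (wf n (sample x n w))})
    (hC1 : condition_C1 p Theta P x theta0 mle)
    (hC2 : condition_C2 p P x theta0 mle)
    (hC3 : condition_C3 P x theta0 mle)
    (hC4 : condition_C4 p P x prior theta0)
    (hC5 : condition_C5 p P x prior theta0 mle wf) :
  let MLE := fun n (w : Omega) => mle n (sample x n w) in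
  let WF := fun n (w : Omega) => wf n (sample x n w) in
  let I0 := fisher p P x theta0 in
  let K0 := fun n => Kmat p P x n theta0 in
  let A0 := fun n => cox_snell p P x n theta0 in
  let a0 := avec p P x prior theta0 in
  let Bias := bias (P theta0) theta0 in
  [/\ op (P theta0) (fun n w => WF n w - MLE n w - invmx (K0 n) *m a0)
        (fun n => n%:R^-1),
      op (P theta0) (fun n w => WF n w - MLE n w - n%:R^-1 *: (invmx I0 *m a0))
        (fun n => n%:R^-1) &
      [/\ \forall n \near \oo, integrable_vector (P theta0) (WF n),
          (fun n => Bias (WF n) - (Bias (MLE n) + invmx (K0 n) *m a0))
            =o_\oo (fun n => n%:R^-1 : R) &
          (fun n => Bias (WF n) -
             (invmx (K0 n) *m A0 n *m vec_cols (invmx (K0 n))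
              + invmx (K0 n) *m a0))
            =o_\oo (fun n => n%:R^-1 : R)]].
Proof.
move=> MLE WF I0 K0 A0 a0 Bias.
have [hll hroot _ [iMLE csO]] := hC1.
have [hobs K0u] := hC2; have [hrem [N0 uie]] := hC5.
have [V [oV Vpos pd aC1]] := hC4.
have [U [oU hU]] := hll.
pose a := avec p P x prior.
pose D n w := WF n w - MLE n w.
pose e n w := D n w - invmx (K0 n) *m a0.
(* At sample size one, [Kmat] is the Fisher information itself. *)
have I0u : I0 \in unitmx.
  by have := K0u 1%N isT; rewrite /Kmat scale1r.
have invK n : (0 < n)%N -> invmx (K0 n) = n%:R^-1 *: invmx I0.
  by move=> n0; rewrite /K0 /Kmat invmxZ//; exact: K0u.
have msample n : measurable_fun setT (@sample _ _ _ _ x n).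
  apply/measurable_fun_tnthP => i.
  rewrite (_ : _ \o _ = x i); first by have [+ _] := hx; apply.
  by apply/funext => w /=; rewrite tnth_mktuple.
have mMLE n i : measurable_fun setT (fun w => MLE n w i 0).
  exact: (measurableT_comp (hmle n i) (msample n)).
have mWF n i : measurable_fun setT (fun w => WF n w i 0).
  exact: (measurableT_comp (hwf n i) (msample n)).
have mne n : measurable_fun setT (fun w => `|n%:R *: e n w|).
  apply: measurable_mx_norm => i j; rewrite ord1.
  under eq_fun do rewrite !mxE -[WF _ _ _ _]/(WF n _ i 0).
  by apply: measurable_funM => //; apply: measurable_funB => //;
    apply: measurable_funB.
(* For positive [n], [D] is [n^-1] times the sum of [n e], bounded in probability by uniform
   integrability, and the constant [I0^-1 a0]. *)
have OpD1 : Op (P theta0) D (fun n => n%:R^-1).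
  apply: Op_near_eq (Op_scale (OpD (uniformly_integrable_Op mne uie)
    (Op_cst (P theta0) (invmx I0 *m a0)))).
  near=> n; apply/funext => w.
  have n0 : (0 < n)%N by near: n; exact: nbhs_infty_gt.
  rewrite scalerDr scalerA mulVf ?pnatr_eq0 -?lt0n// scale1r.
  by rewrite scalemxAl -invK// subrK.
have opWF : op (P theta0) (fun n w => WF n w - theta0) (fun=> 1).
  have := opD (Op_op1 (@cvg_inv_nat R) OpD1)
    (Op_op1 (@cvg_inv_sqrt_nat R) hC3).
  congr op; apply/funext => n; apply/funext => w.
  by rewrite /D addrA subrK.
pose E n w := - hessian (ell p (sample x n w)) (MLE n w) - K0 n.
have opED : op (P theta0) (fun n w => E n w *m D n w) (fun=> 1).
  apply: Op_op1 (Op_mulmx hobs OpD1).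
  (* The product of the rates, [sqrt n * n^-1], equals [(sqrt n)^-1]; at [n = 0] both are 0. *)
  apply: cvg_trans (@cvg_inv_sqrt_nat R); apply: near_eq_cvg.
  apply: nearW => n.
  have [->|n0] := posnP n; first by rewrite sqrtr0 mul0r invr0.
  by rewrite -{3}(@sqr_sqrtr R n%:R)// expr2 invfM mulrA divff ?mul1r//
    sqrtr_eq0 -ltNge ltr0n.
have ca : {for theta0, continuous a}.
  apply: continuous_col => i; have [/(_ theta0) + _] := aC1 i.
  by apply; case: oV.
have opR1 : op (P theta0) (remainder p x mle wf) (fun=> 1).
  apply: op_le hrem; near=> n; rewrite invf_le1 ?ler1n ?ltr0n;
    near: n; exact: nbhs_infty_gt.
(* The bracket in the formula for [e]: with probability tending to one, [Z = K0 D - a0], that is,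
   [e = n^-1 I0^-1 Z]. *)
pose Z n w := remainder p x mle wf n w + (a (WF n w) - a0) - E n w *m D n w.
have opZ : op (P theta0) Z (fun=> 1).
  by apply: opD (opN opED); apply: opD => //; exact: op1_continuous.
(* Taking the interior means that [WF] in [W] provides a whole neighbourhood of [WF] with the
   regularity that stationarity requires. *)
pose W := interior (U `&` V `&` Theta).
have W0 : nbhs theta0 W.
  apply: nbhs_interior; apply: filterI => //.
  by apply: filterI; exact: open_nbhs_nbhs.
have goodW := op1_nbhs opWF W0.
have op1 : op (P theta0) e (fun n => n%:R^-1).
  (* [Q] gathers the almost sure conditions into one event for each [n], and only the four
     consequences used below are kept. *)
  have [Q HQ aeQ] : exists2 Q : nat -> Omega -> Prop, (forall n w, Q n w ->
      [/\ forall theta, U theta -> loglik p (sample x n w) theta \is a fin_num,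
        has_partials U (ell p (sample x n w)),
        grad (ell p (sample x n w)) (MLE n w) = 0 &
        is_wallace_freeman p Theta P x prior (sample x n w) (WF n w)]) &
      \forall n \near \oo, {ae P theta0, forall w, Q n w}.
    pose Q n w := ((forall theta, U theta ->
        loglik p (sample x n w) theta \is a fin_num) /\
        C_on 2 U (ell p (sample x n w))) /\
      ([/\ interior Theta (MLE n w),
        has_partials [set MLE n w] (ell p (sample x n w)) &
        grad (ell p (sample x n w)) (MLE n w) = 0] /\
      is_wallace_freeman p Theta P x prior (sample x n w) (WF n w)).
    exists Q => [n w [[lU [_ [dU _]]] [[_ _ g0] wfmin]] //|].
    apply: filterS2 hroot hWF => n h1 h2.
    by apply: filterS3 (hU n) h1 h2 => w l1 l2 l3; split.
  (* The identity [e = n^-1 I0^-1 Z] can fail only outside [Q] or when [WF] lies outside [W], and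
     both events vanish. *)
  apply: op_eq (op_scale_mulmx (invmx I0) opZ).
  apply: vanishing_sub (vanishingU (vanishing_ae aeQ) goodW).
  near=> n.
  have n0 : (0 < n)%N by near: n; exact: nbhs_infty_gt.
  move=> w /=; apply: contra_notP => /not_orP[/contrapT /HQ[lU dU g0 wfmin]].
  move=> /contrapT Ww.
  have gWF : grad (ell p (sample x n w)) (WF n w) = - a (WF n w).
    apply: (wallace_freeman_stationary wfmin).
    apply: filterS Ww => theta [[Ut Vt] Tt]; split=> //.
    have [q0 D0] := Vpos _ Vt.
    split; [exact: lU|exact: pen_fin_num|by move=> i; exact: dU|].
    by move=> i; exact: pd.
  (* After substituting [grad ell (WF) = - a (WF)] and [grad ell (MLE) = 0], both the [a (WF)] terms
     and the Hessian terms cancel. *)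
  have ZE : Z n w = K0 n *m D n w - a0.
    rewrite /Z /remainder -/(MLE n w) -/(WF n w) -/(D n w) gWF g0 subr0.
    rewrite /E mulmxBl mulNmx opprB.
    move: (a (WF n w)) (hessian _ _ *m _) (K0 n *m _) {+}a0 => b h k c.
    rewrite opprK [- b - h]addrC [_ + (b - c)]addrA subrK.
    by rewrite [- h - c]addrC [k + h]addrC addrA subrK addrC.
  rewrite ZE scalemxAl -invK// mulmxBr mulKmx//; exact: K0u.
have [iWF biasWF] := bias_littleo theta0 mWF mMLE iMLE uie op1.
split=> //.
  (* The two forms of the leading term agree for every [n > 0], so the exceptional event is
     eventually empty. *)
  apply: op_eq op1 => eps eps0; near=> n.
  have n0 : (0 < n)%N by near: n; exact: nbhs_infty_gt.
  exists set0; split=> //; last by rewrite measure0 lee_fin ltW.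
  by move=> w /=; rewrite /e invK// scalemxAl.
split=> //.
apply/eqoP => eps eps0; have e2 : 0 < eps / 2 by rewrite divr_gt0.
move/eqoP : biasWF => /(_ _ e2) biasWF.
move/eqO_exP : csO => [k k0 csO].
near=> n.
have n0 : (0 < n)%N by near: n; exact: nbhs_infty_gt.
(* Inserting the bias of the MLE leaves the first bias expansion and the Cox--Snell error, each
   allotted [eps / 2]. *)
have splitB (u v c k' : 'cV[R]_d) : u - (c + k') = u - (v + k') + (v - c).
  by rewrite [c + k']addrC [v + k']addrC !opprD !addrA subrK.
have -> : Bias (WF n) - (invmx (K0 n) *m A0 n *m vec_cols (invmx (K0 n))
      + invmx (K0 n) *m a0) =
    (Bias (WF n) - (Bias (MLE n) + invmx (K0 n) *m a0)) +
    (Bias (MLE n) - cox_snell_bias p P x n theta0).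
  exact: splitB.
rewrite (le_trans (ler_normD _ _))// (splitr eps) mulrDl lerD//.
  by near: n.
(* The Cox--Snell error is at most [k n^-2], which is below [(eps / 2) n^-1] once [n] reaches
   [(eps / 2)^-1 * k]. *)
apply: (@le_trans _ _ (k * `|n%:R ^- 2 : R|)); first by near: n.
rewrite !ger0_norm ?invr_ge0// -exprVn expr2 mulrA ler_wpM2r ?invr_ge0//.
rewrite ler_pdivrMr ?ltr0n// -ler_pdivrMl//.
by near: n; exact: nbhs_infty_ger.
Unshelve. all: by end_near. Qed.
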